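(* Let $K=\mathbb{F}_q$ be a finite field. Let $\mathcal{G}$ be a graph with $m$ connected components, each of which is an even cycle $C_{2l_i}$ ($i=1,\ldots,m$), and let $n=2k$ be the number of vertices of $\mathcal{G}$ (so $k=\sum_{i=1}^m l_i$ and the number of edges is $s=n=2k$). Let $\mathbb{X}\subseteq\mathbb{P}^{s-1}$ be the toric set over $K$ parameterized by the edges of $\mathcal{G}$, with vanishing ideal $I_{\mathbb{X}}\subseteq S=K[X_1,\ldots,X_s]$. Then $$\mathrm{reg}(S/I_{\mathbb{X}})=(q-2)(k-1).$$
   Context: Let $K^*=K\setminus\{0\}$. Graphs are simple. $C_{2l}$ denotes the cycle with $2l$ vertices. For a simple graph $\mathcal{G}$ with vertices $v_1,\ldots,v_n$ and edges $e_1,\ldots,e_s$, the toric set parameterized by the edges of $\mathcal{G}$ is the set $\mathbb{X}\subseteq\mathbb{P}^{s-1}$ of all points, for $(t_1,\ldots,t_n)\in(K^* )^n$, whose $i$-th coordinate is $t_jt_l$ when $e_i=\{v_j,v_l\}$. With $S=\oplus_{d\ge0}S_d$ standard graded, $I_{\mathbb{X}}$ is the ideal generated by the homogeneous polynomials vanishing at all points of $\mathbb{X}$, $H_{\mathbb{X}}(d)=\dim_K(S_d/(I_{\mathbb{X}}\cap S_d))$, and the regularity index $\mathrm{reg}(S/I_{\mathbb{X}})$ is the least integer $d\ge0$ such that $H_{\mathbb{X}}(d)=|\mathbb{X}|$. *)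

(* Defs.v *)
From HB Require Import structures.
From mathcomp Require Import all_boot all_order all_algebra.
From mathcomp Require Import mpoly.

Set Implicit Arguments.
Unset Strict Implicit.
Unset Printing Implicit Defensive.

Import GRing.Theory.
Local Open Scope ring_scope.

Section Graphs.
Variables (V : finType) (e : rel V).

Definition simple_graph : Prop := ssrbool.symmetric e /\ irreflexive e.

Definition edge_set : {set {set V}} :=
  [set [set p.1; p.2] | p : V * V & e p.1 p.2].

(* an enumeration e_1, ..., e_s of the edges, without repetition *)
Definition edge_enumeration (s : nat) (ed : 'I_s -> {set V}) : Prop :=
  injective ed /\ [set ed i | i : 'I_s] = edge_set.

Definition components : {set {set V}} :=
  equivalence_partition (connect e) [set: V].

(* ordS is the cyclic successor on 'I_N.  The bound 2 < N is needed for C_N to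
   be a simple graph with N edges. *)
Definition cycle_adj (N : nat) : rel 'I_N :=
  [rel i j | (j == ordS i) || (i == ordS j)].

Definition induces_cycle (A : {set V}) (N : nat) : Prop :=
  (2 < N)%N /\
  exists f : 'I_N -> V,
    [/\ injective f,
        [set f i | i : 'I_N] = A
      & forall i j, e (f i) (f j) = cycle_adj i j].

End Graphs.

Section ProjectiveSets.
Variables (K : finFieldType) (s : nat).

(* The point [v] of P^(s-1), as the set of its homogeneous coordinate vectors;
   finite because K is. *)
Definition proj_point (v : 'rV[K]_s) : {set 'rV[K]_s} :=
  [set c *: v | c : K & c != 0].

Definition vanishes_on (X : {set {set 'rV[K]_s}}) (f : {mpoly K[s]}) : Prop :=
  forall P : {set 'rV[K]_s}, P \in X ->
  forall v : 'rV[K]_s, v \in P -> f.@[fun i => v 0 i] = 0.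

Definition ideal_gen (G : {mpoly K[s]} -> Prop) (f : {mpoly K[s]}) : Prop :=
  exists (r : nat) (a g : 'I_r -> {mpoly K[s]}),
    (forall i, G (g i)) /\ f = \sum_(i < r) a i * g i.

Definition vanishing_ideal (X : {set {set 'rV[K]_s}}) : {mpoly K[s]} -> Prop :=
  ideal_gen (fun g => g \is homog mdeg /\ vanishes_on X g).

(* dim_K (U / W) = h, for subspaces W of U: some h vectors of U form a basis of
   the quotient, i.e. every class has unique coordinates on them. *)
Definition has_quotient_dim (L : lmodType K) (U W : L -> Prop) (h : nat) : Prop :=
  exists b : 'I_h -> L,
    (forall i, U (b i)) /\
    forall u, U u -> exists! c : 'rV[K]_h, W (u - \sum_(i < h) c 0 i *: b i).

(* H_X(d) = h *)
Definition hilbert_value (X : {set {set 'rV[K]_s}}) (d h : nat) : Prop :=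
  has_quotient_dim (fun f : {mpoly K[s]} => f \is d.-homog)
                   (fun f => vanishing_ideal X f /\ f \is d.-homog) h.

(* reg(S/I_X) = r *)
Definition regularity_index (X : {set {set 'rV[K]_s}}) (r : nat) : Prop :=
  hilbert_value X r #|X| /\
  forall d : nat, hilbert_value X d #|X| -> (r <= d)%N.

End ProjectiveSets.

Section ToricSet.
Variables (K : finFieldType) (V : finType) (s : nat) (ed : 'I_s -> {set V}).

(* the i-th coordinate is t_j t_l for ed i = {v_j, v_l}, j <> l *)
Definition edge_vector (t : {ffun V -> K}) : 'rV[K]_s :=
  \row_(i < s) \prod_(v in ed i) t v.

Definition toric_set : {set {set 'rV[K]_s}} :=
  [set proj_point (edge_vector t) | t : {ffun V -> K} & [forall v, t v != 0]].

End ToricSet.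

(* Main.v *)
Require Import Defs.
From mathcomp Require Import all_boot all_order all_algebra.
From mathcomp Require Import mpoly.
From mathcomp Require Import finfield zify.

(* Write q = #|K|.  Each even cycle splits into two perfect matchings, so the
   edges split into a perfect matching M and its complement, also a perfect
   matching, and prod_(i in M) X_i = prod_(i notin M) X_i on the toric set X.
   Since nonzero scalars are (q-1)-th roots of unity, a monomial function on X
   only depends on its exponents modulo q-1, and adding c on M while subtracting
   c off M does not change it.
   Upper bound: averaged over c in Z/(q-1), the reduced exponents have total
   degree k(q-2); hence every monomial of degree congruent to (q-2)(k-1) modulo
   q-1 agrees on X with one of degree exactly (q-2)(k-1).  The indicator
   function of a point, expanded in characters, is thus given by a form of that
   degree.
   Lower bound: if forms of degree d < (q-2)(k-1) interpolate every function on
   X, then a form of degree k(q-2) - (q-1) takes the value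
   prod_v t_v^(q-2) on X.  Multiplying by prod_v t_v and summing over the torus,
   some monomial of this form must have at each vertex v a total exponent
   congruent to -1 modulo q-1, hence at least q-2.  As each edge has two ends,
   its degree is at least k(q-2), a contradiction. *)

Set Implicit Arguments.
Unset Strict Implicit.
Unset Printing Implicit Defensive.

Import GRing.Theory.

(** * Even cycles as unions of two perfect matchings *)

Section TwoMatchings.

Lemma odd_ordS (N : nat) (i : 'I_N) : ~~ odd N -> odd (ordS i) = ~~ odd i.
Proof.
move=> evN; have /= := congr1 odd (divn_eq i.+1 N).
by rewrite oddD oddM (negbTE evN) andbF.
Qed.

Lemma odd_ord_pred (N : nat) (i : 'I_N) :
  ~~ odd N -> odd (ord_pred i) = ~~ odd i.
Proof. by move=> evN; rewrite -[i in RHS]ord_predK odd_ordS ?negbK. Qed.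

(** Equality would give [i + 2 = i] modulo [N], so [N] would divide 2. *)
Lemma ordS_neq_ord_pred (N : nat) (i : 'I_N) : 2 < N -> ordS i != ord_pred i.
Proof.
move=> N2; apply/eqP=> /(congr1 (@ordS N)); rewrite ord_predK => /(congr1 val).
rewrite /= -addn1 modnDml addn1 -addn2 -[RHS](modn_small (ltn_ord i)).
by rewrite -[in RHS](addn0 i) => /eqP; rewrite eqn_modDl mod0n modn_small.
Qed.

Lemma even_cycle_matchings (N : nat) : ~~ odd N -> 2 < N ->
  exists m1 m2 : 'I_N -> 'I_N,
    [/\ involutive m1, involutive m2, forall i, m1 i != m2 i
      & forall i j, cycle_adj i j = (j == m1 i) || (j == m2 i)].
Proof.
move=> evN N2.
(* The edges of the cycle are taken alternately. Going around an even cycle flips parity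
   consistently, so both maps are involutions. *)
exists (fun i : 'I_N => if odd i then ord_pred i else ordS i).
exists (fun i : 'I_N => if odd i then ordS i else ord_pred i); split=> i.
- case oi: (odd i); [rewrite odd_ord_pred // oi ord_predK //|].
  by rewrite odd_ordS // oi ordSK.
- case oi: (odd i); [rewrite odd_ordS // oi ordSK //|].
  by rewrite odd_ord_pred // oi ord_predK.
- by case: ifP => _; [rewrite eq_sym|]; apply: ordS_neq_ord_pred.
move=> j; rewrite /cycle_adj /=.
have -> : (i == ordS j) = (j == ord_pred i).
  by apply/eqP/eqP => ->; rewrite ?ordSK ?ord_predK.
by case: ifP => _ //; rewrite orbC.
Qed.

Variables (V : finType) (e : rel V).

Lemma induced_even_cycle_matchings (A : {set V}) (l : nat) :
  induces_cycle e A (2 * l) ->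
  exists m : (V -> V) * (V -> V), forall v, v \in A ->
    [/\ m.1 v \in A /\ m.2 v \in A, m.1 (m.1 v) = v, m.2 (m.2 v) = v,
        m.1 v != m.2 v
      & forall w, w \in A -> e v w = (w == m.1 v) || (w == m.2 v)].
Proof.
case=> N2 [f [injf <- adjf]].
have evN : ~~ odd (2 * l) by rewrite mul2n odd_double.
have [m1 [m2 [m1K m2K m12 adj]]] := even_cycle_matchings evN N2.
(* Transport along [f]; the default [v] off the cycle is never inspected. *)
pose ext (g : 'I_(2 * l) -> 'I_(2 * l)) v :=
  if [pick j | f j == v] is Some j then f (g j) else v.
have extE g j : ext g (f j) = f (g j).
  rewrite /ext; case: pickP => [j' /eqP/injf -> //|/(_ j)].
  by rewrite eqxx.
exists (ext m1, ext m2) => v /imsetP[i _ ->] /=.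
rewrite !extE m1K m2K inj_eq //; split=> //.
  by split; apply: imset_f.
by move=> w /imsetP[j _ ->]; rewrite adjf adj !inj_eq.
Qed.

Lemma even_cycles_matchings (I : finType) (C : I -> {set V}) (l : I -> nat) :
  injective C ->
  ssrbool.symmetric e -> [set C i | i : I] = components e ->
  (forall i, induces_cycle e (C i) (2 * l i)) ->
  exists m1 m2 : V -> V,
    [/\ involutive m1, involutive m2, forall v, m1 v != m2 v
      & forall v w, e v w = (w == m1 v) || (w == m2 v)].
Proof.
move=> injC syme CE Ccyc.
have eqvC : {in [set: V] & &, equivalence_rel (connect e)}.
  by move=> x y z _ _ _; apply: (equivalence_relP _).2; split;
     [exact: connect0 | exact: same_connect (sym_connect_sym syme)].
have compP v : exists i, v \in C i.
  have := equivalence_partitionP eqvC; rewrite -/(components e) -CE.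
  case/and3P=> /eqP covC _ _.
  have: v \in cover [set C i | i : I] by rewrite covC.
  by case/bigcupP=> A /imsetP[i _ ->]; exists i.
have {compP}[c cP] := fin_all_exists compP.
have inC i v w : v \in C i -> w \in C i = connect e v w.
  have := equivalence_partitionP eqvC; rewrite -/(components e) -CE.
  case/and3P=> _ tI _ vi.
  have Ci : C i \in [set C i | i : I] by apply: imset_f.
  rewrite -(def_pblock tI Ci vi) CE.
  by rewrite pblock_equivalence_partition ?inE.
have cE i v : v \in C i -> c v = i.
  move=> vi; apply: injC; apply/setP=> w.
  by rewrite (inC _ _ _ vi) (inC _ _ _ (cP v)).
have [m mP] := fin_all_exists (fun i => induced_even_cycle_matchings (Ccyc i)).
pose g1 v := (m (c v)).1 v; pose g2 v := (m (c v)).2 v.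
have gP v := mP _ _ (cP v).
exists g1, g2; split=> v; have [[in1 in2] m1K m2K m12 adj] := gP v.
- by rewrite /g1 (cE _ _ in1).
- by rewrite /g2 (cE _ _ in2).
- by [].
(* If [w] lies in another component, both sides are false: an edge would connect [v] to [w], and
   both matchings preserve the component of [v]. *)
move=> w; have [/adj //|wC] := boolP (w \in C (c v)).
rewrite [LHS](contraNF _ wC) => [|evw]; last first.
  by rewrite (inC _ _ _ (cP v)) connect1.
by apply/esym/norP; split; apply: contraNneq wC => ->.
Qed.
Lemma even_cycles_edge_matchings (I : finType) (C : I -> {set V})
    (l : I -> nat) (s : nat) (ed : 'I_s -> {set V}) :
  injective C ->
  simple_graph e -> [set C i | i : I] = components e ->
  (forall i, induces_cycle e (C i) (2 * l i)) -> edge_enumeration e ed ->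
  exists M : {set 'I_s}, forall v, exists i j,
    [/\ i \in M, j \notin M & forall h, (v \in ed h) = (h == i) || (h == j)].
Proof.
move=> injC [syme irre] CE Ccyc [injed edE].
have [m1 [m2 [m1K m2K m12 adj]]] := even_cycles_matchings injC syme CE Ccyc.
(* [M] collects the edges of the first matching; the two edges at [v] lead to [m1 v] and [m2 v]. *)
exists [set i | [exists v, ed i == [set v; m1 v]]] => v.
have edgeP w : e v w -> exists i, ed i = [set v; w].
  move=> evw; have : [set v; w] \in edge_set e.
    by apply/imsetP; exists (v, w); rewrite ?inE.
  by rewrite -edE => /imsetP[i _ ->]; exists i.
have [|i iE] := edgeP (m1 v); first by rewrite adj eqxx.
have [|j jE] := edgeP (m2 v); first by rewrite adj eqxx orbT.
exists i, j; split.
- by rewrite inE; apply/existsP; exists v; rewrite iE.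
(* Were the edge from [v] to [m2 v] in [M], it would contain [m1 v], forcing [m1 v = m2 v] or a loop
   at [v]. *)
- rewrite inE jE; apply/existsP=> -[u /eqP/setP uE].
  have : m1 v \in [set v; m2 v].
    have : v \in [set u; m1 u] by rewrite -uE set21.
    rewrite uE !inE => /orP[]/eqP->; first by rewrite eqxx orbT.
    by rewrite m1K eqxx.
  rewrite !inE (negbTE (m12 v)) orbF => /eqP m1v.
  by have := irre v; rewrite adj m1v eqxx.
move=> h; apply/idP/idP; last by case/orP=> /eqP->; rewrite ?iE ?jE set21.
have : ed h \in edge_set e by rewrite -edE imset_f.
case/imsetP=> -[a b]; rewrite inE /= => eab hE.
rewrite hE !inE => /orP[]/eqP vE.
  have:= eab; rewrite -vE adj; case/orP=> /eqP bE; apply/orP; [left|right].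
    by apply/eqP/injed; rewrite hE iE -vE bE.
  by apply/eqP/injed; rewrite hE jE -vE bE.
have:= eab; rewrite syme -vE adj; case/orP=> /eqP aE; apply/orP; [left|right].
  by apply/eqP/injed; rewrite hE iE -vE aE setUC.
by apply/eqP/injed; rewrite hE jE -vE aE setUC.
Qed.
End TwoMatchings.

(** * Power sums and geometric sums over a finite field *)

Section PowerSums.
Local Open Scope ring_scope.
Variable K : finFieldType.

Lemma card_finField_gt1 : (1 < #|K|)%N.
Proof.
by rewrite (cardD1 0) (cardD1 1) !inE oner_eq0.
Qed.

Lemma expf_card_pred (x : K) : x != 0 -> x ^+ #|K|.-1 = 1.
Proof.
move=> x0; apply: (mulfI x0); rewrite -exprS.
by rewrite prednK ?(ltnW card_finField_gt1) // expf_card mulr1.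
Qed.

Lemma expf_mod_card_pred (x : K) e : x != 0 -> x ^+ (e %% #|K|.-1)%N = x ^+ e.
Proof.
move=> x0; rewrite [in RHS](divn_eq e #|K|.-1) exprD mulnC exprM.
by rewrite expf_card_pred // expr1n mul1r.
Qed.

(** Translation by 1 permutes [K], so comparing the sums of all elements before and after gives
    [q = 0] in [K]. *)
Lemma natr_card_pred : #|K|.-1%:R = -1 :> K.
Proof.
have: \sum_(x : K) x = \sum_(x : K) (x + 1) by exact: (reindex_inj (addIr 1)).
rewrite big_split /= sumr_const -[LHS]addr0 => /addrI.
rewrite -(prednK (ltnW card_finField_gt1)) mulrSr => /eqP.
by rewrite eq_sym addr_eq0 => /eqP.
Qed.

Lemma sum_expf (e : nat) :
  \sum_(u : K | u != 0) u ^+ e = if (#|K|.-1 %| e)%N then -1 else 0.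
Proof.
case: ifP => [/dvdnP[c ->]|ndiv].
  rewrite (eq_bigr (fun=> 1)) => [|u u0]; last first.
    by rewrite mulnC exprM expf_card_pred // expr1n.
  rewrite sumr_const -natr_card_pred -(cardC1 (0 : K)).
  by congr (_ *+ _); apply: eq_card => u; rewrite !inE.
(* Otherwise, with [r] the nonzero residue of [e] modulo [q - 1], the polynomial [X^r - 1] would
   have [q - 1 > r] roots. *)
have [w w0 we] : exists2 w : K, w != 0 & w ^+ e != 1.
  apply/exists_inP; apply: contraFT ndiv.
  rewrite negb_exists_in => /forall_inP h.
  have r_lt : (e %% #|K|.-1 < #|K|.-1)%N.
    by rewrite ltn_mod -ltnS prednK ?card_finField_gt1 // ltnW //
       card_finField_gt1.
  apply/eqP/eqP; case: posnP => // r0; exfalso.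
  pose p := 'X^(e %% #|K|.-1)%N - 1 : {poly K}.
  have sp : size p = (e %% #|K|.-1).+1%N by rewrite size_XnsubC.
  have pn0 : p != 0 by rewrite -size_poly_gt0 sp.
  have rootp : all (root p) (enum (predC1 (0 : K))).
    apply/allP=> u; rewrite mem_enum inE => u0.
    rewrite rootE !hornerE ?hornerXn expf_mod_card_pred //.
    by rewrite (eqP (negbNE (h u u0))) subrr.
  have := max_poly_roots pn0 rootp (enum_uniq _).
  by rewrite -cardE cardC1 sp ltnS leqNgt r_lt.
(* Multiplication by [w] permutes the nonzero elements, so the sum [S] satisfies [S = w^e S]; if [S]
   were nonzero, [w^e] would be 1. *)
apply/eqP; have := we; apply: contraNT => S0.
apply/eqP/(mulIf S0); rewrite mul1r [in RHS](reindex_inj (mulfI w0)) mulr_sumr.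
apply: eq_big => u; first by rewrite mulf_eq0 negb_or w0.
by rewrite exprMn.
Qed.

Lemma geometric_sum_finField (y : K) : y != 0 ->
  \sum_(a < #|K|.-1) y ^+ a = - (y == 1)%:R.
Proof.
move=> y0; have [->|y1] := eqVneq y 1.
  rewrite -natr_card_pred (eq_bigr (fun=> 1)) => [|i _]; last exact: expr1n.
  by rewrite sumr_const card_ord.
apply: (mulfI (_ : y - 1 != 0)); first by rewrite subr_eq0.
by rewrite -subrX1 expf_card_pred // subrr oppr0 mulr0.
Qed.

End PowerSums.

(** * The Hilbert function and interpolation at the points *)

Section HilbertFunction.
Local Open Scope ring_scope.
Variables (K : finFieldType) (s : nat).
Implicit Types (f g : {mpoly K[s]}) (v : 'rV[K]_s) (X : {set {set 'rV[K]_s}}).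

Definition evalv f v : K := f.@[fun i => v 0 i].

Lemma evalv_sum (I : finType) (F : I -> {mpoly K[s]}) v :
  evalv (\sum_i F i) v = \sum_i evalv (F i) v.
Proof. by rewrite /evalv raddf_sum. Qed.

Lemma evalv_homogZ d f (c : K) v :
  f \is d.-homog -> evalv f (c *: v) = c ^+ d * evalv f v.
Proof.
move=> /dhomogP hf; rewrite /evalv !mevalE mulr_sumr.
apply: eq_big_seq => m /hf <-.
rewrite mulrCA; congr (_ * _); rewrite -[X in c ^+ X]/(mdeg m) mdegE.
rewrite expr_sum -big_split.
by apply: eq_bigr => i _; rewrite mxE exprMn.
Qed.

Variables (X : {set {set 'rV[K]_s}}) (rep : 'I_#|X| -> 'rV[K]_s).
Hypothesis repP : forall i, enum_val i = proj_point (rep i).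

(** Rescaling a point multiplies the value of a form by a power of the scalar, so one representative
    per point suffices. *)
Lemma vanishing_ideal_homog d f : f \is d.-homog ->
  vanishing_ideal X f <-> forall i, evalv f (rep i) = 0.
Proof.
move=> hf; split=> [[r [a [g [gP ->]]]] i|f0].
  rewrite evalv_sum big1 // => h _; rewrite /evalv mevalM.
  have [_ /(_ _ (enum_valP i) (rep i))->] := gP h; first by rewrite mulr0.
  by rewrite repP; apply/imsetP; exists 1; rewrite ?scale1r // inE oner_neq0.
exists 1%N, (fun=> 1), (fun=> f); split=> [_|]; last by rewrite big_ord1 mul1r.
split=> [|P PX v]; first by apply/homogP; exists d.
rewrite -(enum_rankK_in PX PX) repP => /imsetP[c _ ->].
by rewrite -/(evalv f _) (evalv_homogZ _ _ hf) f0 mulr0.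
Qed.

(** Separating forms are a basis of the quotient: the coordinates of a form are its values at the
    representatives. *)
Lemma hilbert_value_separators d :
  (forall i, exists2 f, f \is d.-homog &
     forall j, evalv f (rep j) = (i == j)%:R) ->
  hilbert_value X d #|X|.
Proof.
move=> /fin_all_exists2[b bh bE]; exists b; split=> // u uh.
have sumh (c : 'rV[K]_#|X|) : \sum_i c 0 i *: b i \is d.-homog.
  by apply: rpred_sum => i _; apply: rpredZ.
have evE (c : 'rV[K]_#|X|) j :
    evalv (u - \sum_i c 0 i *: b i) (rep j) = evalv u (rep j) - c 0 j.
  rewrite /evalv mevalB; congr (_ - _); rewrite -/(evalv _ _) evalv_sum.
  rewrite (bigD1 j) //= big1 => [|i ij]; rewrite /evalv mevalZ -/(evalv _ _) bE.
    by rewrite eqxx mulr1 addr0.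
  by rewrite (negbTE ij) mulr0.
have subh c := rpredB uh (sumh c).
exists (\row_j evalv u (rep j)); split.
  by split; rewrite ?subh //; apply/(vanishing_ideal_homog (subh _)) => j;
     rewrite evE mxE subrr.
move=> c [/(vanishing_ideal_homog (subh c)) c0 _]; apply/rowP=> j.
by rewrite mxE; apply/eqP; rewrite -subr_eq0 -evE c0.
Qed.

Lemma hilbert_value_interpolation d (y : 'I_#|X| -> K) :
  hilbert_value X d #|X| ->
  exists2 f, f \is d.-homog & forall j, evalv f (rep j) = y j.
Proof.
case=> b [bh bU]; pose A := \matrix_(i, j) evalv (b i) (rep j).
have sumh (c : 'rV[K]_#|X|) : \sum_i c 0 i *: b i \is d.-homog.
  by apply: rpred_sum => i _; apply: rpredZ.
have sumE (c : 'rV[K]_#|X|) j :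
    evalv (\sum_i c 0 i *: b i) (rep j) = (c *m A) 0 j.
  by rewrite evalv_sum mxE; apply: eq_bigr => i _; rewrite mxE /evalv mevalZ.
(* A row [c] with [c *m A = 0] gives a combination vanishing on [X], hence coordinates of the class
   of 0; these are unique, so [c = 0]. *)
have uA : A \in unitmx.
  rewrite -row_free_unit -kermx_eq0; apply/eqP/row_matrixP=> i; rewrite row0.
  set c := row i _; have cA : c *m A = 0 by rewrite -row_mul mulmx_ker row0.
  have [c0 [_ uniq_c0]] := bU 0 (rpred0 _).
  have W (c' : 'rV_#|X|) : c' *m A = 0 -> c0 = c'.
    move=> c'A; apply: uniq_c0; rewrite sub0r rpredN; split=> //.
    have h : - (\sum_i c' 0 i *: b i) \is d.-homog by rewrite rpredN.
    apply/(vanishing_ideal_homog h) => j.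
    by rewrite /evalv mevalN -/(evalv _ _) sumE c'A mxE oppr0.
  by rewrite -(W c) // (W 0) // mul0mx.
exists (\sum_i ((\row_j y j) *m invmx A) 0 i *: b i) => // j.
by rewrite sumE mulmxKV // mxE.
Qed.

End HilbertFunction.

(** * Monomials on the toric set, with [p = q - 2] *)

Section Toric.
Local Open Scope ring_scope.
Variables (K : finFieldType) (p : nat) (V : finType) (s k : nat).
Variables (ed : 'I_s -> {set V}) (M : {set 'I_s}).
Hypothesis cardK : #|K| = p.+2.
Hypothesis cardV : #|V| = (2 * k)%N.
Hypothesis card_ed : forall i, #|ed i| = 2.
Hypothesis matchings : forall v, exists i j,
  [/\ i \in M, j \notin M & forall h, (v \in ed h) = (h == i) || (h == j)].

Local Notation torus := [pred t : {ffun V -> K} | [forall v, t v != 0]].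
Local Notation x := (edge_vector ed).

Lemma edge_vector_neq0 (t : {ffun V -> K}) i : t \in torus -> x t 0 i != 0.
Proof. by move/forallP=> t0; rewrite mxE; apply/prodf_neq0 => v _. Qed.

Lemma prod_edge_vector (g : 'I_s -> nat) (t : {ffun V -> K}) :
  \prod_i x t 0 i ^+ g i = \prod_v t v ^+ (\sum_(i | v \in ed i) g i).
Proof.
transitivity (\prod_i \prod_(v in ed i) t v ^+ g i).
  by apply: eq_bigr => i _; rewrite mxE prodrXl.
rewrite (exchange_big_dep xpredT) //=; apply: eq_bigr => v _.
by rewrite expr_sum.
Qed.

Lemma sum_incident_edges (g : 'I_s -> nat) :
  (\sum_v \sum_(i | v \in ed i) g i = 2 * \sum_i g i)%N.
Proof.
rewrite (exchange_big_dep xpredT) //= big_distrr /=; apply: eq_bigr => i _.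
by rewrite sum_nat_const card_ed.
Qed.

Lemma incident_matching v :
  (\sum_(i | v \in ed i) (i \in M) = 1)%N /\
  (\sum_(i | v \in ed i) (i \notin M) = 1)%N.
Proof.
have [i [j [iM jM edE]]] := matchings v.
have ij : i != j by apply: contraNneq jM => <-.
have sumE (g : 'I_s -> nat) : (\sum_(h | v \in ed h) g h = g i + g j)%N.
  rewrite (eq_bigl _ _ edE) (bigD1 i) ?eqxx //=; congr (_ + _)%N.
  rewrite (big_pred1 j) // => h; case: (eqVneq h i) => [->|hi] /=.
    by rewrite (negbTE ij).
  by rewrite andbT.
by rewrite !sumE iM (negbTE jM).
Qed.

(** Each class meets every vertex in exactly one edge, and each edge has two ends, so twice its size
    is [2k]. *)
Lemma card_matching : (#|M| = k /\ #|~: M| = k)%N.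
Proof.
have cardE (B : {set 'I_s}) :
    (forall v, \sum_(i | v \in ed i) (i \in B) = 1)%N -> #|B| = k.
  move=> B1; apply/eqP; rewrite -(eqn_pmul2l (isT : 0 < 2)%N) -cardV.
  rewrite -sum1_card big_mkcond /= -sum_incident_edges.
  by rewrite (eq_bigr (fun=> 1%N)) ?sum1_card.
split; apply: cardE => v; first by have [] := incident_matching v.
by under eq_bigr do rewrite inE; have [] := incident_matching v.
Qed.

Lemma num_edges : s = (2 * k)%N.
Proof.
rewrite -(card_ord s) -(cardsC M) card_matching.1 card_matching.2.
by rewrite addnn mul2n.
Qed.

(** A perfect matching covers each vertex once, so its edge coordinates multiply to the product of
    all [t v]. *)
Lemma prod_edge_vector_matching (t : {ffun V -> K}) e :
  \prod_i x t 0 i ^+ ((i \in M) * e) = \prod_v t v ^+ e /\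
  \prod_i x t 0 i ^+ ((i \notin M) * e) = \prod_v t v ^+ e.
Proof.
split; rewrite prod_edge_vector; apply: eq_bigr => v _;
  have [e1 e2] := incident_matching v;
  by rewrite -big_distrl /= ?e1 ?e2 mul1n.
Qed.

(* Moving along the binomial [prod_(i in M) X_i - prod_(i notin M) X_i], which
   vanishes on the toric set. *)
Definition shift (a : 'I_s -> 'I_p.+1) (c : 'I_p.+1) (i : 'I_s) : 'I_p.+1 :=
  if i \in M then a i + c else a i - c.

Lemma eval_shift a c (t : {ffun V -> K}) : t \in torus ->
  \prod_i x t 0 i ^+ shift a c i = \prod_i x t 0 i ^+ a i.
Proof.
move=> t0; have expK (y : K) e : y != 0 -> y ^+ (e %% p.+1)%N = y ^+ e.
  by move=> /(expf_mod_card_pred e); rewrite cardK.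
have [e1 e2] := prod_edge_vector_matching t c.
have n0 : \prod_i x t 0 i ^+ ((i \notin M) * c) != 0.
  by apply/prodf_neq0 => i _; rewrite expf_neq0 ?edge_vector_neq0.
(* Multiplying by the product off [M], rewritten on the right as the equal product over [M], turns
   the subtraction of [c] off [M] into an addition. *)
apply: (mulIf n0); rewrite [in RHS]e2 -e1 -!big_split; apply: eq_bigr => i _ /=.
have xi := edge_vector_neq0 i t0; rewrite /shift; case: ifP => _ /=.
  by rewrite mul0n mul1n mulr1 expK // exprD.
rewrite mul0n mul1n mulr1 -[in RHS](subrK c (a i)).
by rewrite /= [in RHS]expK // exprD.
Qed.

Lemma sum_shift_mod a c :
  (\sum_i shift a c i = \sum_i a i %[mod p.+1])%N.
Proof.
have: (\sum_i shift a c i + \sum_i (i \notin M) * c =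
       \sum_i a i + \sum_i (i \in M) * c %[mod p.+1])%N.
  rewrite -!big_split /=.
  elim/big_ind2: _ => // [u u' w w' E1 E2|i _].
    by rewrite -modnDm E1 E2 modnDm.
  rewrite /shift; case: ifP => _ /=.
    by rewrite mul1n mul0n addn0 modn_mod.
  by rewrite mul0n mul1n addn0 -[in RHS](subrK c (a i)) /= modn_mod.
rewrite -!big_distrl /=.
have -> : (\sum_i (i \notin M) = k)%N.
  rewrite -card_matching.2 -sum1_card [RHS]big_mkcond.
  by apply: eq_bigr => i _; rewrite inE.
have -> : (\sum_i (i \in M) = k)%N.
  by rewrite -card_matching.1 -sum1_card [RHS]big_mkcond.
by move/eqP; rewrite eqn_modDr => /eqP.
Qed.

(** Averaging: for fixed [i], the shifted exponent runs once through the residues modulo [p + 1],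
    with mean [p / 2]; there are [2k] edges. *)
Lemma exists_small_shift a : exists c, (\sum_i shift a c i <= k * p)%N.
Proof.
apply/existsP; apply: contraT; rewrite negb_exists => /forallP big.
have sumc q : (2 * \sum_(c < q.+1) c = q.+1 * q)%N.
  elim: q => [|q IHq]; first by rewrite big_ord1.
  by rewrite big_ord_recr mulnDr IHq /=; lia.
have : (\sum_(c < p.+1) \sum_i shift a c i = k * (p.+1 * p))%N.
  rewrite exchange_big /= -sumc mulnA [(k * 2)%N]mulnC -num_edges.
  rewrite -[s in RHS]card_ord -sum_nat_const; apply: eq_bigr => i _.
  rewrite /shift; case: (i \in M).
    by rewrite [RHS](reindex_inj (addrI (a i))).
  by rewrite [RHS](reindex_inj (inv_inj (subKr (a i)))).
apply: contra_eqT => _; rewrite neq_ltn; apply/orP; right.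
have : (\sum_(c < p.+1) (k * p).+1 <= \sum_(c < p.+1) \sum_i shift a c i)%N.
  by apply: leq_sum => c _; rewrite ltnNge.
by apply: leq_trans; rewrite sum_nat_const card_ord; nia.
Qed.

Lemma monomial_representative (i0 : 'I_s) (a : 'I_s -> 'I_p.+1) :
  (\sum_i a i = p * (k - 1) %[mod p.+1])%N ->
  exists g : 'X_{1..s}, mdeg g = (p * (k - 1))%N /\
    forall t : {ffun V -> K}, t \in torus ->
      \prod_i x t 0 i ^+ g i = \prod_i x t 0 i ^+ a i.
Proof.
move=> adeg; have [c cS] := exists_small_shift a.
have := sum_shift_mod a c; rewrite adeg; move: cS.
set S := (\sum_i _)%N => cS Smod.
have k0 : (0 < k)%N by have := num_edges; case: (k) i0 => // [[]]; lia.
(* The next value in this residue class is [p(k - 1) + p + 1 = kp + 1], beyond the bound on [S]. *)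
have SD : (S <= p * (k - 1))%N.
  rewrite leqNgt; apply/negP => lt; have/eqP := Smod.
  rewrite eqn_mod_dvd 1?ltnW // => /dvdn_leq; rewrite subn_gt0 => /(_ lt).
  by nia.
have /eqP := esym Smod; rewrite eqn_mod_dvd // => /dvdnP[w wE].
(* The missing degree is a multiple of [p + 1], filled by a power of [X_i0^(p+1)], which is 1 on the
   torus. *)
exists ([multinom (shift a c i : nat) | i < s]
        + U_(i0) *+ (w * p.+1))%MM; split.
  rewrite mdegD mdegMn mdeg1 mul1n -wE mdegE.
  by under eq_bigr do rewrite mnmE; rewrite subnKC.
move=> t t0; rewrite -(eval_shift a c t0).
apply: eq_bigr => i _; rewrite mnmDE mnmE exprD mulmnE mnm1E.
rewrite -[RHS]mulr1; congr (_ * _); rewrite mulnA mulnC exprM.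
have := expf_card_pred (edge_vector_neq0 i t0).
by rewrite cardK => ->; rewrite expr1n.
Qed.

(** * Upper bound: forms separating the points *)

Lemma sum_monomials_degree (y : 'I_s -> K) d : (forall i, y i != 0) ->
  \sum_(a : {ffun 'I_s -> 'I_p.+1} | (\sum_i a i == d %[mod p.+1])%N)
     \prod_i y i ^+ a i =
  - \sum_(u : K | u != 0) u ^+ (d * p) * \prod_i - (u * y i == 1)%:R.
Proof.
move=> y0; have NK : #|K|.-1 = p.+1 by rewrite cardK.
(* Since [dp] is [-d] modulo [p + 1], the power sum over [u] detects the degree congruence; the sum
   over [a] then factors into geometric sums. *)
transitivity (- \sum_(u : K | u != 0) \sum_(a : {ffun 'I_s -> 'I_p.+1})
    u ^+ (d * p + \sum_i a i) * \prod_i y i ^+ a i).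
  rewrite exchange_big /= -sumrN big_mkcond; apply: eq_bigr => a _ /=.
  rewrite -mulr_suml sum_expf NK.
  have -> : (p.+1 %| d * p + \sum_i a i = (\sum_i a i == d %[mod p.+1]))%N.
    rewrite -[RHS](eqn_modDl (d * p)) -mulnSr modnMl -/(dvdn _ _) //.
  by case: ifP => _; rewrite ?mulN1r ?opprK ?mul0r ?oppr0.
congr (- _); apply: eq_bigr => u u0.
under [LHS]eq_bigr => a _ do rewrite exprD -mulrA.
rewrite -mulr_sumr; congr (_ * _).
transitivity (\prod_i \sum_(j < p.+1) (u * y i) ^+ j); last first.
  apply: eq_bigr => i _.
  by rewrite -geometric_sum_finField ?mulf_neq0 // NK.
rewrite bigA_distr_bigA; apply: eq_bigr => a _.
by rewrite expr_sum -big_split; apply: eq_bigr => i _; rewrite exprMn.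
Qed.

(** A term of the value survives only if [u *: x t = x t0], so the form vanishes off the projective
    point of [x t0]. *)
Lemma toric_separator (i0 : 'I_s) (t0 : {ffun V -> K}) : t0 \in torus ->
  exists2 f : {mpoly K[s]}, f \is (p * (k - 1)).-homog &
    forall t, t \in torus -> evalv f (x t) =
      - \sum_(u : K | u != 0) u ^+ (p * (k - 1) * p) *
          \prod_i - (u * (x t 0 i / x t0 0 i) == 1)%:R.
Proof.
set d := (p * (k - 1))%N => t00.
have /fin_all_exists[g gP] (a : {ffun 'I_s -> 'I_p.+1}) :
    exists g : 'X_{1..s}, (\sum_i a i == d %[mod p.+1])%N ->
      mdeg g = d /\ forall t : {ffun V -> K}, t \in torus ->
      \prod_i x t 0 i ^+ g i = \prod_i x t 0 i ^+ a i.
  have [/eqP ad|_] := boolP (\sum_i a i == d %[mod p.+1])%N; last first.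
    (* Placeholder for exponents outside the congruence class, which the sum defining the form
       omits. *)
    by exists 0%MM.
  by have [g gP] := monomial_representative i0 ad; exists g.
exists (\sum_(a : {ffun 'I_s -> 'I_p.+1} | (\sum_i a i == d %[mod p.+1])%N)
          (\prod_i (x t0 0 i)^-1 ^+ a i) *: 'X_[g a]).
  by apply: rpred_sum => a /gP[ga _]; apply: rpredZ; rewrite dhomogX /= ga.
move=> t tt; rewrite -sum_monomials_degree => [|i]; last first.
  by rewrite mulf_neq0 ?invr_neq0 ?edge_vector_neq0.
rewrite /evalv raddf_sum /=; apply: eq_bigr => a /gP[_ ga].
rewrite mevalZ mevalX ga // -big_split; apply: eq_bigr => i _.
by rewrite exprMn mulrC.
Qed.

Lemma proj_pointZ (u : K) (v : 'rV[K]_s) :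
  u != 0 -> proj_point (u *: v) = proj_point v.
Proof.
move=> u0; apply/setP=> w; apply/imsetP/imsetP => -[c]; rewrite inE => c0 ->.
  by exists (c * u); rewrite ?scalerA // inE mulf_neq0.
by exists (c / u); rewrite ?scalerA ?divfK // inE mulf_neq0 ?invr_neq0.
Qed.

Lemma toric_set_representatives :
  exists t : 'I_#|toric_set K ed| -> {ffun V -> K},
    forall i, t i \in torus /\ enum_val i = proj_point (x (t i)).
Proof.
have /fin_all_exists[t tP] (i : 'I_#|toric_set K ed|) :
    exists t : {ffun V -> K}, t \in torus /\ enum_val i = proj_point (x t).
  by have /imsetP[t] := enum_valP i; rewrite inE => tt ->; exists t.
by exists t.
Qed.

Lemma hilbert_value_toric (i0 : 'I_s) :
  hilbert_value (toric_set K ed) (p * (k - 1)) #|toric_set K ed|.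
Proof.
have [t tP] := toric_set_representatives.
have tt i := (tP i).1; have tE i := (tP i).2.
apply: (hilbert_value_separators tE) => i.
have [f fh fE] := toric_separator i0 (tt i).
(* At the point itself all the ratios are 1, so only [u = 1] contributes. *)
have fi : evalv f (x (t i)) != 0.
  rewrite fE // oppr_eq0 (bigD1 1) ?oner_neq0 //=.
  rewrite [X in _ + X]big1 => [|u /andP[_ u1]].
    rewrite addr0 expr1n mul1r; apply/prodf_neq0 => h _.
    by rewrite divff ?edge_vector_neq0 // mulr1 eqxx oppr_eq0 oner_neq0.
  rewrite (bigD1 i0) //= divff ?edge_vector_neq0 // mulr1 (negbTE u1).
  by rewrite oppr0 mul0r mulr0.
exists ((evalv f (x (t i)))^-1 *: f) => [|j]; first exact: rpredZ.
rewrite /evalv mevalZ; have [<-|ij] := eqVneq i j; first by rewrite mulVf.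
rewrite [X in _ * X](_ : _ = 0) ?mulr0 // [LHS]fE // big1 ?oppr0 // => u u0.
(* Otherwise [u] would rescale one representative to the other, and the two points would
   coincide. *)
have [h hP] : exists h, u * (x (t j) 0 h / x (t i) 0 h) != 1.
  apply/existsP; rewrite -negb_forall; apply: contra ij => /forallP all1.
  apply/eqP/enum_val_inj; rewrite !tE -(proj_pointZ (x (t j)) u0).
  congr proj_point; apply/rowP=> h; rewrite [RHS]mxE.
  have /eqP := all1 h; rewrite mulrA.
  move/(canRL (divfK (edge_vector_neq0 h (tt i)))).
  by rewrite mul1r => ->.
by rewrite (bigD1 h) //= (negbTE hP) oppr0 mul0r mulr0.
Qed.

(** * Lower bound: summation over the torus *)

Lemma sum_torus (E : V -> nat) :
  \sum_(t in torus) \prod_v t v ^+ E v = \prod_v \sum_(u : K | u != 0) u ^+ E v.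
Proof.
rewrite (bigA_distr_big _ (fun v u => u ^+ E v)) /=.
by apply: eq_bigl => t; apply/forallP/ffun_onP.
Qed.

Lemma torus_form_degree (f : {mpoly K[s]}) d : f \is d.-homog ->
  (forall t, t \in torus -> evalv f (x t) = \prod_v t v ^+ p) ->
  (k * p <= d)%N.
Proof.
move=> /dhomogP fh fE; rewrite leqNgt; apply/negP => dlt.
have NK : #|K|.-1 = p.+1 by rewrite cardK.
have : \sum_(t in torus) evalv f (x t) * \prod_v t v = (-1) ^+ #|V|.
  transitivity (\sum_(t in torus) \prod_v t v ^+ p.+1).
    apply: eq_bigr => t tt; rewrite fE // -big_split.
    by apply: eq_bigr => v _; rewrite exprSr.
  rewrite sum_torus -prodr_const; apply: eq_bigr => v _.
  by rewrite sum_expf NK dvdnn.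
suff -> : \sum_(t in torus) evalv f (x t) * \prod_v t v = 0.
  by move/esym/eqP; rewrite signr_eq0.
under eq_bigr do rewrite /evalv mevalE mulr_suml.
rewrite exchange_big big_seq big1 // => m /fh md /=.
transitivity (\sum_(t in torus)
    f@_m * \prod_v t v ^+ (\sum_(i | v \in ed i) m i).+1).
  apply: eq_bigr => t _; rewrite -mulrA prod_edge_vector -big_split.
  by congr (_ * _); apply: eq_bigr => v _; rewrite exprSr.
rewrite -mulr_sumr sum_torus.
(* A monomial contributes 0 unless [p + 1] divides every vertex exponent plus one; then each vertex
   exponent is at least [p], and counting edge ends gives degree at least [kp]. *)
have [/existsP[v vP]|/existsPn div] :=
    boolP [exists v, ~~ (p.+1 %| (\sum_(i | v \in ed i) m i).+1)%N].
  by rewrite (bigD1 v) //= sum_expf NK (negbTE vP) mul0r mulr0.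
have : (\sum_(v : V) p <= \sum_v \sum_(i | v \in ed i) m i)%N.
  by apply: leq_sum => v _; have /negPn/dvdn_leq := div v; apply.
have md' : (\sum_i m i = d)%N by rewrite -md [RHS]mdegE.
rewrite sum_incident_edges sum_nat_const cardV md' -mulnA leq_pmul2l //.
by rewrite leqNgt dlt.
Qed.

Lemma hilbert_value_toric_degree (i0 : 'I_s) d :
  hilbert_value (toric_set K ed) d #|toric_set K ed| ->
  (p * (k - 1) <= d)%N.
Proof.
move=> hd; rewrite leqNgt; apply/negP=> dlt.
have [t tP] := toric_set_representatives.
have tt i := (tP i).1; have tE i := (tP i).2.
(* Here [c] is the power of [X_i0] that brings degree [d] up to [kp - (p + 1)]. *)
have [c cE] : exists c, (k * p = c + (d + p.+1))%N.
  by exists (k * p - (d + p.+1))%N; nia.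
(* The factor at [i0] is the inverse of [X_i0^c] on the torus. It makes the total degree congruent
   to [d] modulo [p + 1], so the target scales like a form of degree [d]. *)
pose b i := ((i \in M) * p + (i == i0) * (c * p))%N.
have bsum : (\sum_i b i = d + p.+1 * c.+1)%N.
  rewrite big_split -!big_distrl /=.
  have -> : (\sum_i (i \in M) = k)%N.
    by rewrite -card_matching.1 -sum1_card [RHS]big_mkcond.
  have -> : (\sum_i (i == i0) = 1)%N.
    by rewrite (bigD1 i0) //= eqxx big1 // => i /negbTE->.
  by rewrite cE; lia.
have [f fh fE] := hilbert_value_interpolation tE
  (fun j => \prod_i x (t j) 0 i ^+ b i) hd.
have {}fE u : u \in torus -> evalv f (x u) = \prod_i x u 0 i ^+ b i.
  move=> uu; have uX : proj_point (x u) \in toric_set K ed.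
    by apply/imsetP; exists u; rewrite // inE.
  have : x u \in proj_point (x u).
    by apply/imsetP; exists 1; rewrite ?scale1r // inE oner_neq0.
  rewrite -(enum_rankK_in uX uX) tE; set j := enum_rank_in _ _.
  case/imsetP=> w; rewrite inE => w0 ->; rewrite (evalv_homogZ _ _ fh) fE.
  transitivity (\prod_i (w ^+ b i * x (t j) 0 i ^+ b i)).
    rewrite big_split -expr_sum bsum exprD exprM.
    by have := expf_card_pred w0; rewrite cardK => ->; rewrite expr1n mulr1.
  by apply: eq_bigr => i _; rewrite [in RHS]mxE exprMn.
suff: (k * p <= d + c)%N by rewrite cE; lia.
(* The exponent at [i0] gains [cp + c = c(p + 1)], which is trivial on the torus; what remains is
   the product over [M] to the power [p]. *)
apply: (@torus_form_degree (f * 'X_i0 ^+ c)).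
  by apply: dhomogM; rewrite // -[c in c.-homog]mul1n dhomogMn //
     dhomogX /= mdeg1.
move=> u uu; rewrite /evalv mevalM rmorphXn /= mevalXU -/(evalv f _) fE //.
rewrite -(prod_edge_vector_matching u p).1
  (eq_bigr _ (fun i _ => exprD (x u 0 i) _ _)) big_split /= -mulrA.
rewrite [X in _ * X](_ : _ = 1) ?mulr1 //.
rewrite (bigD1 i0) //= eqxx mul1n big1 => [|i /negbTE->]; last by rewrite mul0n.
rewrite mulr1 -exprD -mulnSr mulnC exprM.
have := expf_card_pred (edge_vector_neq0 i0 uu).
by rewrite cardK => ->; rewrite expr1n.
Qed.

End Toric.

(** * The regularity index of the toric set *)

Theorem corollary5p5
  (K : finFieldType)
  (n m k s : nat) (l : 'I_m -> nat)
  (e : rel 'I_n) (C : 'I_m -> {set 'I_n}) (ed : 'I_s -> {set 'I_n}) :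
  simple_graph e ->
  (0 < m)%N ->
  injective C ->
  [set C i | i : 'I_m] = components e ->
  (forall i : 'I_m, induces_cycle e (C i) (2 * l i)) ->
  n = (2 * k)%N ->
  edge_enumeration e ed ->
  regularity_index (toric_set K ed) ((#|K| - 2) * (k - 1))%N.
Proof.
move=> [syme irre] m0 injC CE Ccyc nE [injed edE].
have [M MP] :=
  even_cycles_edge_matchings injC (conj syme irre) CE Ccyc (conj injed edE).
have cardK : #|K| = (#|K| - 2).+2.
  by have := card_finField_gt1 K; lia.
have cardV : #|{: 'I_n}| = 2 * k by rewrite card_ord.
have card_ed i : #|ed i| = 2.
  have : ed i \in edge_set e by rewrite -edE imset_f.
  case/imsetP=> -[a b]; rewrite inE /= => eab ->; rewrite cards2.
  by case: eqVneq eab => // ->; rewrite irre.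
(* Some component exists because [m] is positive, and any of its vertices lies on an edge. *)
have [i0] : exists i0 : 'I_s, true.
  have [N2 [f _]] := Ccyc (Ordinal m0).
  by have [i _] := MP (f (Ordinal (ltnW (ltnW N2)))); exists i.
move=> _; split; first exact: (hilbert_value_toric cardK cardV card_ed MP i0).
by move=> d; apply: (hilbert_value_toric_degree cardK cardV card_ed MP i0).
Qed.
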